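(* Let $\mathcal{R}$ be a commutative ring with unity, $\mathcal{A}$ a unital $\mathcal{R}$-algebra and $\mathcal{M}$ a unital $\mathcal{A}$-bimodule. There is an exact sequence of group homomorphisms $$0\longrightarrow H^1_{\mathcal{A}}(\mathcal{M})\oplus H^1(\mathcal{A},\mathcal{M})\oplus\mathcal{E}(\mathcal{M})\longrightarrow H^1(\mathcal{A}\ltimes\mathcal{M})\xrightarrow{\ \widehat{\pi}_{\mathcal{A}}\ } H^1(\mathcal{A}),$$ where the first (injective) homomorphism sends $([S],[\delta],T)$ to the class of the derivation $(a,m)\mapsto (T(m),\delta(a)+S(m))$ and $\widehat{\pi}_{\mathcal{A}}$ sends the class of a derivation $\mathcal{D}=(\mathcal{D}_{\mathcal{A}}+T,\mathcal{D}_{\mathcal{M}}+S)$ to $[\mathcal{D}_{\mathcal{A}}]$.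
   Context: $\mathcal{A}\ltimes\mathcal{M}$ is the trivial extension algebra: $\mathcal{A}\times\mathcal{M}$ with componentwise addition and scalar multiplication and product $(a,m)(b,n)=(ab,an+mb)$. Every $\mathcal{R}$-linear map $\mathcal{D}$ on $\mathcal{A}\ltimes\mathcal{M}$ has the form $\mathcal{D}(a,m)=(\mathcal{D}_{\mathcal{A}}(a)+T(m),\mathcal{D}_{\mathcal{M}}(a)+S(m))$ with linear maps $\mathcal{D}_{\mathcal{A}}:\mathcal{A}\to\mathcal{A}$, $\mathcal{D}_{\mathcal{M}}:\mathcal{A}\to\mathcal{M}$, $T:\mathcal{M}\to\mathcal{A}$, $S:\mathcal{M}\to\mathcal{M}$; one writes $\mathcal{D}=(\mathcal{D}_{\mathcal{A}}+T,\mathcal{D}_{\mathcal{M}}+S)$. For an algebra $\mathcal{B}$ and $\mathcal{B}$-bimodule $\mathcal{L}$, $H^1(\mathcal{B},\mathcal{L})=\mathrm{Der}(\mathcal{B},\mathcal{L})/\mathrm{Innder}(\mathcal{B},\mathcal{L})$, where $\mathrm{Der}(\mathcal{B},\mathcal{L})$ is the additive group of $\mathcal{R}$-linear derivations $\mathcal{B}\to\mathcal{L}$ and $\mathrm{Innder}(\mathcal{B},\mathcal{L})$ the subgroup of inner derivations $b\mapsto l_0b-bl_0$ ($l_0\in\mathcal{L}$); $H^1(\mathcal{B})=H^1(\mathcal{B},\mathcal{B})$. $\mathcal{E}(\mathcal{M})$ is the group of $\mathcal{A}$-bimodule homomorphisms $f:\mathcal{M}\to\mathcal{A}$ such that $f(m)n+mf(n)=0$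 for all $m,n\in\mathcal{M}$. $H^1_{\mathcal{A}}(\mathcal{M})=\mathrm{End}_{\mathcal{A}-\mathcal{A}}(\mathcal{M})/\mathrm{Innbi}_{\mathcal{A}}(\mathcal{M})$, where $\mathrm{End}_{\mathcal{A}-\mathcal{A}}(\mathcal{M})$ is the additive group of $\mathcal{A}$-bimodule homomorphisms $\mathcal{M}\to\mathcal{M}$ and $\mathrm{Innbi}_{\mathcal{A}}(\mathcal{M})$ is the subgroup of those of the form $m\mapsto a_0m-ma_0$ with $a_0$ in the center $Z(\mathcal{A})$. Square brackets denote classes in quotient groups. *)

(* Defs.v *)
From HB Require Import structures.
From mathcomp Require Import all_boot all_order all_algebra.
From mathcomp Require Import boolp classical_sets functions.

Set Implicit Arguments.
Unset Strict Implicit.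
Unset Printing Implicit Defensive.

Import GRing.Theory.
Local Open Scope ring_scope.

Reserved Notation "a *> m" (at level 40, left associativity).
Reserved Notation "m <* a" (at level 40, left associativity).

(* Unital A-bimodules over an R-algebra A, with R acting centrally: the two
   R-module structures induced by A both coincide with the given one. *)
HB.mixin Record Lmodule_isBimodule (R : comPzRingType) (A : algType R) M
    of GRing.Lmodule R M := {
  lact : A -> M -> M;
  ract : M -> A -> M;
  lact1 : forall m, lact 1 m = m;
  lactA : forall a b m, lact (a * b) m = lact a (lact b m);
  lactDl : forall a b m, lact (a + b) m = lact a m + lact b m;
  lactDr : forall a m n, lact a (m + n) = lact a m + lact a n;
  lactZ : forall (r : R) a m, lact (r *: a) m = r *: lact a m;
  ract1 : forall m, ract m 1 = m;
  ractA : forall m a b, ract m (a * b) = ract (ract m a) b;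
  ractDl : forall m n a, ract (m + n) a = ract m a + ract n a;
  ractDr : forall m a b, ract m (a + b) = ract m a + ract m b;
  ractZ : forall (r : R) m a, ract m (r *: a) = r *: ract m a;
  lractA : forall a m b, ract (lact a m) b = lact a (ract m b)
}.

#[short(type="bimodType")]
HB.structure Definition Bimodule (R : comPzRingType) (A : algType R) :=
  {M of GRing.Lmodule R M & Lmodule_isBimodule R A M}.

Notation "a *> m" := (lact a m) : ring_scope.
Notation "m <* a" := (ract m a) : ring_scope.

Section BimoduleTheory.
Variables (R : comPzRingType) (A : algType R) (M : bimodType A).

Lemma lactr0 (a : A) : a *> 0 = 0 :> M.
Proof. by apply: (addIr (a *> 0)); rewrite -lactDr !add0r. Qed.

Lemma lact0r (m : M) : (0 : A) *> m = 0.
Proof. by apply: (addIr ((0 : A) *> m)); rewrite -lactDl !add0r. Qed.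

Lemma ractr0 (m : M) : m <* (0 : A) = 0.
Proof. by apply: (addIr (m <* (0 : A))); rewrite -ractDr !add0r. Qed.

Lemma ract0r (a : A) : (0 : M) <* a = 0.
Proof. by apply: (addIr ((0 : M) <* a)); rewrite -ractDl !add0r. Qed.

Lemma lactrN (a : A) (m : M) : a *> (- m) = - (a *> m).
Proof. by apply: (addIr (a *> m)); rewrite -lactDr !addNr lactr0. Qed.

Lemma lactNr (a : A) (m : M) : (- a) *> m = - (a *> m).
Proof. by apply: (addIr (a *> m)); rewrite -lactDl !addNr lact0r. Qed.

Lemma ractrN (m : M) (a : A) : m <* (- a) = - (m <* a).
Proof. by apply: (addIr (m <* a)); rewrite -ractDr !addNr ractr0. Qed.

Lemma ractNr (m : M) (a : A) : (- m) <* a = - (m <* a).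
Proof. by apply: (addIr (m <* a)); rewrite -ractDl !addNr ract0r. Qed.

(* r m = (r 1) m = m (r 1), hence A acts by R-linear maps on both sides. *)
Lemma lactZr (a : A) (r : R) (m : M) : a *> (r *: m) = r *: (a *> m).
Proof.
rewrite -{1}[m]lact1 -lactZ -lactA -scalerAr mulr1.
by rewrite lactZ.
Qed.

Lemma ractZl (r : R) (m : M) (a : A) : (r *: m) <* a = r *: (m <* a).
Proof.
rewrite -{1}[m]ract1 -ractZ -ractA -scalerAl mul1r.
by rewrite ractZ.
Qed.

End BimoduleTheory.

Definition regbimod (R : comPzRingType) (A : algType R) : Type := A.

Section RegularBimodule.
Variables (R : comPzRingType) (A : algType R).
HB.instance Definition _ := GRing.Algebra.on (regbimod A).

HB.instance Definition _ := @Lmodule_isBimodule.Build R A (regbimod A)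
  (fun a m => a * m : A) (fun m a => m * a : A)
  (@mul1r A) (fun a b m => esym (@mulrA A a b m))
  (@mulrDl A) (@mulrDr A) (fun r a m => esym (@scalerAl R A r a m))
  (@mulr1 A) (@mulrA A) (@mulrDl A) (@mulrDr A)
  (fun r m a => esym (@scalerAr R A r m a))
  (fun a m b => esym (@mulrA A a m b)).
End RegularBimodule.

(* The tag carries the product (a, m) (b, n) = (a b, a n + m b) instead of the
   componentwise one that MathComp puts on pairs of rings. *)
Definition trivext (R : comPzRingType) (A : algType R) (M : bimodType A) :
  Type := (A * M)%type.

Section TrivialExtension.
Variables (R : comPzRingType) (A : algType R) (M : bimodType A).
Local Notation AM := (trivext M).

HB.instance Definition _ := GRing.Lmodule.copy AM (A * M)%type.

Definition trivext_mul (x y : AM) : AM :=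
  (x.1 * y.1, x.1 *> y.2 + x.2 <* y.1).
Definition trivext_one : AM := (1, 0).

Fact trivext_mulA : associative trivext_mul.
Proof.
move=> x y z; congr pair; rewrite /= ?mulrA //.
by rewrite lactDr ractDl lactA ractA lractA addrA.
Qed.

Fact trivext_mul1 : left_id trivext_one trivext_mul.
Proof.
by case=> a m; congr pair; rewrite /= ?mul1r // lact1 ract0r addr0.
Qed.

Fact trivext_mulr1 : right_id trivext_one trivext_mul.
Proof.
by case=> a m; congr pair; rewrite /= ?mulr1 // ract1 lactr0 add0r.
Qed.

Fact trivext_mulDl : left_distributive trivext_mul +%R.
Proof.
by move=> x y z; congr pair; rewrite /= ?mulrDl // lactDl ractDl addrACA.
Qed.

Fact trivext_mulDr : right_distributive trivext_mul +%R.
Proof.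
by move=> x y z; congr pair; rewrite /= ?mulrDr // lactDr ractDr addrACA.
Qed.

Fact trivext_oner_neq0 : trivext_one != 0 :> AM.
Proof. by rewrite xpair_eqE oner_eq0. Qed.

HB.instance Definition _ := GRing.Zmodule_isNzRing.Build AM
  trivext_mulA trivext_mul1 trivext_mulr1 trivext_mulDl trivext_mulDr
  trivext_oner_neq0.

Fact trivext_scalerAl (r : R) (x y : AM) : r *: (x * y) = (r *: x) * y.
Proof.
congr pair; rewrite /= ?scalerAl //.
by rewrite scalerDr lactZ ractZl.
Qed.

Fact trivext_scalerAr (r : R) (x y : AM) : r *: (x * y) = x * (r *: y).
Proof.
congr pair; rewrite /= ?scalerAr //.
by rewrite scalerDr lactZr ractZ.
Qed.

HB.instance Definition _ :=
  GRing.Lmodule_isLalgebra.Build R AM trivext_scalerAl.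
HB.instance Definition _ :=
  GRing.Lalgebra_isAlgebra.Build R AM trivext_scalerAr.

End TrivialExtension.

Section LinearClosure.
Variables (R : comPzRingType) (U V : lmodType R).

Lemma linear_fun0 : linear (0 : U -> V).
Proof. by move=> r u v; rewrite /= scaler0 addr0. Qed.

Lemma linear_funB (f g : U -> V) : linear f -> linear g -> linear (f - g).
Proof.
move=> lf lg r u v.
have E x : (f - g) x = f x - g x by [].
by rewrite !E lf lg scalerBr opprD addrACA.
Qed.

End LinearClosure.

Section Derivations.
Variables (R : comPzRingType) (B : algType R) (L : bimodType B).

Definition is_derivation (f : B -> L) : Prop :=
  linear f /\ forall a b, f (a * b) = a *> f b + f a <* b.

(* Membership is decided classically so that the library's boolean closed
   predicates, and hence its subgroups and quotients, apply. *)
Definition der_pred : {pred B -> L} := fun f => `[< is_derivation f >].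

Fact der_pred_zmod_closed : zmod_closed der_pred.
Proof.
split=> [|f g /asboolP[lf df] /asboolP[lg dg]]; apply/asboolP; split.
- exact: linear_fun0.
- by move=> a b; rewrite /= lactr0 ract0r addr0.
- exact: linear_funB.
- move=> a b; have E x : (f - g) x = f x - g x by [].
  by rewrite !E df dg lactDr ractDl lactrN ractNr opprD addrACA.
Qed.
HB.instance Definition _ :=
  GRing.isZmodClosed.Build (B -> L) der_pred der_pred_zmod_closed.

Record Der := MkDer { der_fun :> B -> L; _ : der_fun \in der_pred }.
HB.instance Definition _ := [isSub for der_fun].
HB.instance Definition _ := [Choice of Der by <:].
HB.instance Definition _ := [SubChoice_isSubZmodule of Der by <:].

Definition is_inner (d : Der) : Prop :=
  exists l0 : L, forall b : B, d b = l0 <* b - b *> l0.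

Definition Innder : {pred Der} := fun d => `[< is_inner d >].

Fact Innder_zmod_closed : zmod_closed Innder.
Proof.
split=> [|f g /asboolP[l Hl] /asboolP[k Hk]]; apply/asboolP.
- by exists 0 => b; rewrite lactr0 ract0r subr0.
- exists (l - k) => b; have -> : (f - g) b = f b - g b by [].
  by rewrite Hl Hk lactDr ractDl lactrN ractNr !opprD addrACA.
Qed.
HB.instance Definition _ :=
  GRing.isZmodClosed.Build Der Innder Innder_zmod_closed.

Definition H1 : zmodType := Quotient.quot Innder.
Definition H1_class (d : Der) : H1 := (\pi_(Quotient.quot Innder) d)%qT.

End Derivations.

Arguments Der {R} B L.
Arguments Innder {R} B L.
Arguments H1 {R} B L.

Section BimoduleHomomorphisms.
Variables (R : comPzRingType) (A : algType R).

Definition is_bimod_hom (M N : bimodType A) (f : M -> N) : Prop :=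
  [/\ linear f, forall a m, f (a *> m) = a *> f m
              & forall m a, f (m <* a) = f m <* a].

Lemma is_bimod_hom0 (M N : bimodType A) : is_bimod_hom (0 : M -> N).
Proof.
split; first exact: linear_fun0.
- by move=> a m; rewrite /= lactr0.
- by move=> m a; rewrite /= ract0r.
Qed.

Lemma is_bimod_homB (M N : bimodType A) (f g : M -> N) :
  is_bimod_hom f -> is_bimod_hom g -> is_bimod_hom (f - g).
Proof.
move=> [lf fl fr] [lg gl gr].
have E x : (f - g) x = f x - g x by [].
split; first exact: linear_funB.
- by move=> a m; rewrite !E fl gl lactDr lactrN.
- by move=> m a; rewrite !E fr gr ractDl ractNr.
Qed.

Variable M : bimodType A.

Definition End_pred : {pred M -> M} := fun f => `[< is_bimod_hom f >].

Fact End_pred_zmod_closed : zmod_closed End_pred.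
Proof.
split=> [|f g /asboolP Hf /asboolP Hg]; apply/asboolP.
- exact: is_bimod_hom0.
- exact: is_bimod_homB.
Qed.
HB.instance Definition _ :=
  GRing.isZmodClosed.Build (M -> M) End_pred End_pred_zmod_closed.

Record EndAA := MkEndAA { end_fun :> M -> M; _ : end_fun \in End_pred }.
HB.instance Definition _ := [isSub for end_fun].
HB.instance Definition _ := [Choice of EndAA by <:].
HB.instance Definition _ := [SubChoice_isSubZmodule of EndAA by <:].

Definition is_central (a0 : A) : Prop := forall a : A, a0 * a = a * a0.

Definition is_innbi (S : EndAA) : Prop :=
  exists2 a0 : A, is_central a0 & forall m : M, S m = a0 *> m - m <* a0.

Definition Innbi : {pred EndAA} := fun S => `[< is_innbi S >].

Fact Innbi_zmod_closed : zmod_closed Innbi.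
Proof.
split=> [|f g /asboolP[a ca Ha] /asboolP[b cb Hb]]; apply/asboolP.
- exists 0 => [a|m]; first by rewrite mul0r mulr0.
  by rewrite lact0r ractr0 subr0.
- exists (a - b) => [c|m]; first by rewrite mulrBl mulrBr ca cb.
  have -> : (f - g) m = f m - g m by [].
  by rewrite Ha Hb lactDl ractDr lactNr ractrN !opprD addrACA.
Qed.
HB.instance Definition _ :=
  GRing.isZmodClosed.Build EndAA Innbi Innbi_zmod_closed.

Definition H1bimod : zmodType := Quotient.quot Innbi.
Definition H1bimod_class (S : EndAA) : H1bimod :=
  (\pi_(Quotient.quot Innbi) S)%qT.

(* f m n + m f n = 0, where f m and f n act on M as elements of A. *)
Definition is_calE (f : M -> regbimod A) : Prop :=
  is_bimod_hom f /\ forall m n : M, (f m : A) *> n + m <* (f n : A) = 0.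

Definition calE_pred : {pred M -> regbimod A} := fun f => `[< is_calE f >].

Fact calE_pred_zmod_closed : zmod_closed calE_pred.
Proof.
split=> [|f g /asboolP[Hf f0] /asboolP[Hg g0]]; apply/asboolP; split.
- exact: is_bimod_hom0.
- by move=> m n; rewrite /= lact0r ractr0 addr0.
- exact: is_bimod_homB.
- move=> m n; rewrite (lactDl (f m : A) (- g m : A)) (ractDr m (f n : A) (- g n : A)).
  by rewrite lactNr ractrN addrACA f0 -opprD g0 oppr0 addr0.
Qed.
HB.instance Definition _ :=
  GRing.isZmodClosed.Build (M -> regbimod A) calE_pred calE_pred_zmod_closed.

Record calE := MkCalE { calE_fun :> M -> regbimod A; _ : calE_fun \in calE_pred }.
HB.instance Definition _ := [isSub for calE_fun].
HB.instance Definition _ := [Choice of calE by <:].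
HB.instance Definition _ := [SubChoice_isSubZmodule of calE by <:].

End BimoduleHomomorphisms.

Arguments calE {R A} M.
Arguments H1bimod {R A} M.
Arguments EndAA {R A} M.

(* Main.v *)
Require Import Defs.
From HB Require Import structures.
From mathcomp Require Import all_boot all_order all_algebra.
From mathcomp Require Import boolp classical_sets functions.

Set Implicit Arguments.
Unset Strict Implicit.
Unset Printing Implicit Defensive.

Import GRing.Theory.
Local Open Scope ring_scope.

(** Write a linear endomorphism of the trivial extension as a matrix
      [D (a, m) = (D_A a + T m, D_M a + S m)].
    Evaluating the Leibniz rule on products of elements [(a, 0)] and [(0, m)]
    shows that [D] is a derivation exactly when [D_A] and [D_M] are
    derivations, [T] lies in [calE M], and [S] is a bimodule map up to the
    correction
      [S (a m) = a (S m) + (D_A a) m]  and  [S (m a) = (S m) a + m (D_A a)].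
    Hence triples [(S, delta, T)] correspond to the derivations with
    [D_A = 0]; this is [incl].  Likewise
      [[(a0, m0), (a, m)] = ([a0, a], [m0, a] + [a0, m])]
    says that the inner derivations are those with [D_A] and [D_M] inner, by
    [a0] and [m0], with [T = 0] and with [S] equal to [m |-> a0 m - m a0].

    Everything follows from these two facts.  Since [D |-> D_A] sends inner
    derivations to inner ones, it descends to [piA].  An [incl (S, delta, T)]
    is inner iff [T = 0], [delta] is inner and [S] is the commutator with some
    [a0] satisfying [[a0, a] = 0] for all [a], i.e. with a central [a0]
    ([incl_inner]): the kernel of [incl] modulo inner derivations is thus the
    kernel of the triple of quotient maps, which makes [iota] both well
    defined and injective.  Finally, if [D_A] is inner by [a0], subtracting
    from [D] the inner derivation by [(a0, 0)] gives a derivation with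
    [D_A = 0], i.e. one in the image of [incl] ([incl_of_inner]). *)

(** * Additive maps out of quotients *)

(** The universal property is stated for an arbitrary surjection, not for one
    quotient, so that it applies at once to the triple of classes on which
    [iota] is defined. *)
Lemma additive_factor (U Q W : zmodType) (p : {additive U -> Q})
    (f : {additive U -> W}) :
  (forall q, exists u, p u = q) -> (forall u, p u = 0 -> f u = 0) ->
  exists g : {additive Q -> W}, forall u, g (p u) = f u.
Proof.
move=> surj_p ker_pf; have [s sK] := choice surj_p.
have fs u : f (s (p u)) = f u.
  by apply: subr0_eq; rewrite -raddfB ker_pf // raddfB sK subrr.
have gB : zmod_morphism (f \o s).
  by move=> x y /=; rewrite -raddfB -[RHS]fs raddfB !sK.
pose G := GRing.isZmodMorphism.Build _ _ (f \o s) gB.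
by exists (HB.pack_for {additive Q -> W} (f \o s) G) => u; exact: fs.
Qed.

Section QuotientClasses.
Variables (R : comPzRingType) (B : algType R) (L : bimodType B).

Fact H1_class_is_zmod_morphism : zmod_morphism (@H1_class R B L).
Proof. exact: pi_is_zmod_morphism. Qed.
HB.instance Definition _ := GRing.isZmodMorphism.Build _ _ (@H1_class R B L)
  H1_class_is_zmod_morphism.

Lemma H1_class_surj (x : H1 B L) : exists d, H1_class d = x.
Proof. by exists (repr x); rewrite /H1_class reprK. Qed.

Lemma H1_class_eq0 (d : Der B L) : H1_class d = 0 <-> is_inner d.
Proof.
rewrite -(raddf0 (@H1_class R B L)) -[d in is_inner d]subr0.
have E := Quotient.idealrBE (Innder B L) d 0.
split=> [/eqP|Hd]; first by rewrite -E => /asboolP.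
by apply/eqP; rewrite -E; apply/asboolP.
Qed.

Fact H1bimod_class_is_zmod_morphism : zmod_morphism (@H1bimod_class R B L).
Proof. exact: pi_is_zmod_morphism. Qed.
HB.instance Definition _ := GRing.isZmodMorphism.Build _ _ (@H1bimod_class R B L)
  H1bimod_class_is_zmod_morphism.

Lemma H1bimod_class_surj (x : H1bimod L) : exists S, H1bimod_class S = x.
Proof. by exists (repr x); rewrite /H1bimod_class reprK. Qed.

Lemma H1bimod_class_eq0 (S : EndAA L) : H1bimod_class S = 0 <-> is_innbi S.
Proof.
rewrite -(raddf0 (@H1bimod_class R B L)) -[S in is_innbi S]subr0.
have E := Quotient.idealrBE (@Innbi R B L) S 0.
split=> [/eqP|HS]; first by rewrite -E => /asboolP.
by apply/eqP; rewrite -E; apply/asboolP.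
Qed.

Lemma Der_linear (d : Der B L) : linear d.
Proof. by case: d => d /= /asboolP[]. Qed.

HB.instance Definition _ (d : Der B L) :=
  GRing.isLinear.Build R B L *:%R (der_fun d) (Der_linear d).

Lemma Der_mul (d : Der B L) a b : d (a * b) = a *> d b + d a <* b.
Proof. by case: d => d /= /asboolP[]. Qed.

End QuotientClasses.

(** * Matrix form of a derivation of the trivial extension *)

Section Components.
Variables (R : comPzRingType) (A : algType R) (M : bimodType A).
Local Notation AM := (trivext M).
Implicit Type D : Der AM (regbimod AM).

Definition compA D (a : A) : regbimod A := (D (a, 0 : M)).1.
Definition compT D (m : M) : regbimod A := (D (0 : A, m)).1.
Definition compM D (a : A) : M := (D (a, 0 : M)).2.
Definition compS D (m : M) : M := (D (0 : A, m)).2.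

Lemma trivext_Der_linear D (r : R) (a b : A) (m n : M) :
  D (r *: a + b, r *: m + n) = r *: D (a, m) + D (b, n).
Proof. exact: (Der_linear D r (a, m) (b, n)). Qed.

Lemma trivext_Der_mul D (a b : A) (m n : M) :
  D (a * b, a *> n + m <* b) =
    (a * (D (b, n)).1 + (D (a, m)).1 * b,
     a *> (D (b, n)).2 + m <* ((D (b, n)).1 : A)
     + (((D (a, m)).1 : A) *> n + (D (a, m)).2 <* b)) :> AM.
Proof. exact: (Der_mul D (a, m) (b, n)). Qed.

Lemma comp_decomp D (a : A) (m : M) :
  D (a, m) = (compA D a + compT D m, compM D a + compS D m) :> AM.
Proof.
have := trivext_Der_linear D 1 a 0 0 m.
by rewrite !scale1r addr0 add0r.
Qed.

Lemma compA_linear D : linear (compA D).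
Proof.
move=> r a b; have := trivext_Der_linear D r a b 0 0.
by rewrite scaler0 addr0 /compA => ->.
Qed.
HB.instance Definition _ D :=
  GRing.isLinear.Build R A (regbimod A) *:%R (compA D) (compA_linear D).

Lemma compM_linear D : linear (compM D).
Proof.
move=> r a b; have := trivext_Der_linear D r a b 0 0.
by rewrite scaler0 addr0 /compM => ->.
Qed.
HB.instance Definition _ D :=
  GRing.isLinear.Build R A M *:%R (compM D) (compM_linear D).

Lemma compT_linear D : linear (compT D).
Proof.
move=> r m n; have := trivext_Der_linear D r 0 0 m n.
by rewrite scaler0 addr0 /compT => ->.
Qed.
HB.instance Definition _ D :=
  GRing.isLinear.Build R M (regbimod A) *:%R (compT D) (compT_linear D).

Lemma compS_linear D : linear (compS D).
Proof.
move=> r m n; have := trivext_Der_linear D r 0 0 m n.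
by rewrite scaler0 addr0 /compS => ->.
Qed.
HB.instance Definition _ D :=
  GRing.isLinear.Build R M M *:%R (compS D) (compS_linear D).

Lemma compA_mul D (a b : A) :
  compA D (a * b) = a * (compA D b : A) + (compA D a : A) * b :> A.
Proof.
have := trivext_Der_mul D a b 0 0; rewrite lactr0 ract0r addr0.
by rewrite /compA => ->.
Qed.

Lemma compM_mul D (a b : A) :
  compM D (a * b) = a *> compM D b + compM D a <* b.
Proof.
have := trivext_Der_mul D a b 0 0.
by rewrite /compM lactr0 !ract0r addr0 => ->; rewrite /= lactr0 add0r addr0.
Qed.

(** Since [(0, m) (0, n) = 0], the Leibniz rule on such a product has zero
    left-hand side, and its [M]-component is the defining relation of
    [calE M]. *)
Lemma compT_calE D : is_calE (compT D).
Proof.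
split; first split; first exact: compT_linear.
- move=> a m; have := trivext_Der_mul D a 0 0 m.
  by rewrite /compT mulr0 ract0r addr0 => -> /=; rewrite mulr0 addr0.
- move=> m a; have := trivext_Der_mul D 0 a m 0.
  by rewrite /compT mul0r lact0r add0r => -> /=; rewrite mul0r add0r.
move=> m n; have := congr1 snd (trivext_Der_mul D 0 0 m n).
rewrite /= mul0r lact0r !ractr0 addr0 lact0r add0r addr0 addrC /compT => <-.
exact: (raddf0 (compS D)).
Qed.

Lemma compS_lact D (a : A) (m : M) :
  compS D (a *> m) = a *> compS D m + (compA D a : A) *> m.
Proof.
have := trivext_Der_mul D a 0 0 m.
by rewrite /compS mulr0 ract0r addr0 => -> /=; rewrite ract0r ractr0 !addr0.
Qed.

Lemma compS_ract D (m : M) (a : A) :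
  compS D (m <* a) = compS D m <* a + m <* (compA D a : A).
Proof.
have := trivext_Der_mul D 0 a m 0.
by rewrite /compS mul0r lact0r add0r => -> /=; rewrite lact0r lactr0 !add0r addrC.
Qed.

Fact derA_subproof D : compA D \in @der_pred R A (regbimod A).
Proof. by apply/asboolP; split; [exact: compA_linear | exact: compA_mul]. Qed.
Definition derA D : Der A (regbimod A) := MkDer (derA_subproof D).

Fact derM_subproof D : compM D \in @der_pred R A M.
Proof. by apply/asboolP; split; [exact: compM_linear | exact: compM_mul]. Qed.
Definition derM D : Der A M := MkDer (derM_subproof D).

Fact homT_subproof D : compT D \in @calE_pred R A M.
Proof. by apply/asboolP; exact: compT_calE. Qed.
Definition homT D : calE M := MkCalE (homT_subproof D).

Fact derA_is_zmod_morphism : zmod_morphism derA.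
Proof. by move=> D E; apply: val_inj. Qed.
HB.instance Definition _ := GRing.isZmodMorphism.Build _ _ derA
  derA_is_zmod_morphism.

(** The right-hand side lists the entries of the commutator with [(a0, m0)];
    the same [a0] governs the entries on [A] and on [M], which is what ties
    the class of [compS D] to central elements when [compA D] vanishes. *)
Lemma trivext_innerP D :
  is_inner D <-> exists (a0 : A) (m0 : M),
    [/\ forall a, compA D a = a0 * a - a * a0 :> A,
        forall a, compM D a = m0 <* a - a *> m0,
        forall m, compT D m = 0
      & forall m, compS D m = a0 *> m - m <* a0].
Proof.
split=> [[[a0 m0] DE]|[a0 [m0 [EA EM ET ES]]]].
  exists a0, m0; split=> [a|a|m|m].
  - by rewrite /compA DE.
  - by rewrite /compM DE /= !lactr0 !ract0r add0r addr0.
  - by rewrite /compT DE /= mulr0 mul0r subr0.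
  - by rewrite /compS DE /= !ractr0 !lact0r add0r addr0.
exists (a0, m0) => -[a m]; rewrite comp_decomp EA EM ET ES addr0.
rewrite [RHS]surjective_pairing /=; congr pair.
by rewrite opprD [X in _ = X + _]addrC addrACA.
Qed.

End Components.

(** * Derivations whose component on A vanishes *)

Section Inclusion.
Variables (R : comPzRingType) (A : algType R) (M : bimodType A).
Local Notation AM := (trivext M).

Lemma EndAA_bimod_hom (S : EndAA M) : is_bimod_hom S.
Proof. by case: S => S /= /asboolP. Qed.

Lemma EndAA_linear (S : EndAA M) : linear S.
Proof. by have [] := EndAA_bimod_hom S. Qed.
HB.instance Definition _ (S : EndAA M) :=
  GRing.isLinear.Build R M M *:%R (end_fun S) (EndAA_linear S).

Lemma calE_is_calE (T : calE M) : is_calE T.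
Proof. by case: T => T /= /asboolP. Qed.

Lemma calE_linear (T : calE M) : linear T.
Proof. by have [[]] := calE_is_calE T. Qed.
HB.instance Definition _ (T : calE M) :=
  GRing.isLinear.Build R M (regbimod A) *:%R (calE_fun T) (calE_linear T).

Definition incl_fun (x : EndAA M * Der A M * calE M) (p : AM) : regbimod AM :=
  (x.2 p.2, x.1.2 p.1 + x.1.1 p.2).

Fact incl_subproof x : incl_fun x \in @der_pred R AM (regbimod AM).
Proof.
case: x => -[S d] T; have [_ Sl Sr] := EndAA_bimod_hom S.
have [[_ Tl Tr] TT] := calE_is_calE T.
apply/asboolP; split=> [r [a m] [b n]|[a m] [b n]]; rewrite /incl_fun /=.
  congr pair; rewrite /= ?linearP //.
  by rewrite scalerDr addrACA.
congr pair; first by rewrite raddfD /= Tl Tr.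
rewrite Der_mul raddfD /= Sl Sr lactDr ractDl.
(* The terms [m (T n)] and [(T m) n] cancel by the definition of [calE]. *)
rewrite [RHS]addrA -[X in _ = X + _]addrA [m <* _ + _]addrC TT addr0.
exact: addrACA.
Qed.

Definition incl x : Der AM (regbimod AM) := MkDer (incl_subproof x).

Fact incl_is_zmod_morphism : zmod_morphism incl.
Proof.
move=> x y; apply: val_inj; apply: funext => p; congr pair => /=.
by rewrite [RHS]/= opprD addrACA.
Qed.
HB.instance Definition _ := GRing.isZmodMorphism.Build _ _ incl
  incl_is_zmod_morphism.

Definition classes (x : EndAA M * Der A M * calE M) :
    H1bimod M * H1 A M * calE M :=
  (H1bimod_class x.1.1, H1_class x.1.2, x.2).

Fact classes_is_zmod_morphism : zmod_morphism classes.
Proof. by move=> x y; rewrite /classes !raddfB. Qed.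
HB.instance Definition _ := GRing.isZmodMorphism.Build _ _ classes
  classes_is_zmod_morphism.

Lemma classes_surj y : exists x, classes x = y.
Proof.
case: y => -[s d] T; have [S <-] := H1bimod_class_surj s.
by have [D <-] := H1_class_surj d; exists (S, D, T).
Qed.

Lemma compA_incl x a : compA (incl x) a = 0.
Proof. exact: raddf0. Qed.

Lemma compM_incl x a : compM (incl x) a = x.1.2 a.
Proof. by rewrite /compM /= raddf0 addr0. Qed.

Lemma compT_incl x m : compT (incl x) m = x.2 m.
Proof. by []. Qed.

Lemma compS_incl x m : compS (incl x) m = x.1.1 m.
Proof. by rewrite /compS /= raddf0 add0r. Qed.

(** An inner derivation killing the component on [A] comes from an [a0] that
    commutes with all of [A]: this is why commutators with central elements
    only are divided out of the bimodule endomorphisms of [M]. *)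
Lemma incl_inner x : is_inner (incl x) <-> classes x = 0.
Proof.
rewrite trivext_innerP; split=> [[a0 [m0 [EA EM ET ES]]]|].
  have Z S d T : S = 0 -> d = 0 -> T = 0 ->
    (S, d, T) = 0 :> H1bimod M * H1 A M * calE M by move=> -> -> ->.
  apply: Z.
  - apply/H1bimod_class_eq0; exists a0 => [a|m]; last by rewrite -compS_incl.
    by apply: subr0_eq; have := EA a; rewrite compA_incl => <-.
  - by apply/H1_class_eq0; exists m0 => a; rewrite -compM_incl.
  - by apply: val_inj; apply: funext => m; exact: (ET m).
case=> /H1bimod_class_eq0[a0 ca0 HS] /H1_class_eq0[m0 Hd] T0.
exists a0, m0; split=> [a|a|m|m].
- by rewrite compA_incl ca0 subrr.
- by rewrite compM_incl Hd.
- by rewrite compT_incl T0.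
- by rewrite compS_incl HS.
Qed.

(** The twist in the multiplicativity of [compS D] is governed by [compA D];
    if the latter is inner, it is the twist of a commutator map, so that the
    difference is a genuine bimodule endomorphism. *)
Fact compS_sub_ad_subproof (D : Der AM (regbimod AM)) (a0 : A) :
  (forall a, compA D a = a0 * a - a * a0 :> A) ->
  (fun m => compS D m - (a0 *> m - m <* a0)) \in @End_pred R A M.
Proof.
move=> DA.
have linl : linear (fun m : M => a0 *> m).
  by move=> r m n; rewrite lactDr lactZr.
have linr : linear (fun m : M => m <* a0).
  by move=> r m n; rewrite ractDl ractZl.
apply/asboolP; split=> [|a m|m a].
- exact: linear_funB (compS_linear D) (linear_funB linl linr).
- rewrite compS_lact DA lactDl lactNr !lactA lractA.
  rewrite lactDr !lactrN lactDr lactrN -addrA; congr (_ + _).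
  by rewrite !opprB addrC subrKA.
- rewrite compS_ract DA ractDr ractrN !ractA -lractA.
  rewrite ractDl !ractNr ractDl ractNr -addrA; congr (_ + _).
  by rewrite !opprB subrKA.
Qed.

Lemma incl_of_inner (D : Der AM (regbimod AM)) :
  is_inner (derA D) -> exists x, is_inner (D - incl x).
Proof.
case=> a0 DA; pose S := MkEndAA (compS_sub_ad_subproof DA).
pose x := (S, derM D, homT D); exists x; apply/trivext_innerP.
exists a0, 0; split=> [a|a|m|m].
- have -> : compA (D - incl x) a = compA D a - compA (incl x) a by [].
  by rewrite compA_incl subr0; exact: DA.
- have -> : compM (D - incl x) a = compM D a - compM (incl x) a by [].
  by rewrite compM_incl ract0r lactr0 !subrr.
- have -> : compT (D - incl x) m = compT D m - compT (incl x) m by [].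
  by rewrite compT_incl subrr.
- have -> : compS (D - incl x) m = compS D m - compS (incl x) m by [].
  by rewrite compS_incl subKr.
Qed.

Lemma derA_inner (D : Der AM (regbimod AM)) : is_inner D -> is_inner (derA D).
Proof. by case/trivext_innerP=> a0 [m0 [DA _ _ _]]; exists a0. Qed.

Lemma derA_incl x : derA (incl x) = 0.
Proof. by apply: val_inj; apply: funext => a; exact: compA_incl. Qed.

End Inclusion.

(** * The exact sequence *)

Theorem corollary4p3 (R : comPzRingType) (A : algType R) (M : bimodType A) :
  exists (iota : {additive (H1bimod M * H1 A M * calE M)
                   -> H1 (trivext M) (regbimod (trivext M))})
         (piA : {additive H1 (trivext M) (regbimod (trivext M))
                   -> H1 A (regbimod A)}),
  [/\ (* iota ([S], [delta], T) = [(a, m) |-> (T m, delta a + S m)] *)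
      forall (S : EndAA M) (delta : Der A M) (T : calE M),
        exists2 D : Der (trivext M) (regbimod (trivext M)),
          forall (a : A) (m : M), D (a, m) = (T m, delta a + S m)
          & iota (H1bimod_class S, H1_class delta, T) = H1_class D,
      (* piA [D] = [D_A] for D = (D_A + T, D_M + S) *)
      forall D : Der (trivext M) (regbimod (trivext M)),
        exists (DA : Der A (regbimod A)) (T : {linear M -> regbimod A})
               (DM : {linear A -> M}) (S : {linear M -> M}),
          (forall (a : A) (m : M), D (a, m) = (DA a + T m, DM a + S m))
          /\ piA (H1_class D) = H1_class DA,
      injective iota
    & forall x : H1 (trivext M) (regbimod (trivext M)),
        piA x = 0 <-> exists y, iota y = x].
Proof.
pose AM := trivext M; pose cl := @H1_class R AM (regbimod AM).
have [iota iotaE] : exists iota : {additive _ -> H1 AM (regbimod AM)},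
    forall x, iota (@classes R A M x) = (cl \o @incl R A M) x.
  by apply: additive_factor (@classes_surj R A M) _ => x /incl_inner /H1_class_eq0.
have [piA piAE] : exists piA : {additive _ -> H1 A (regbimod A)},
    forall D, piA (cl D) = (@H1_class R A (regbimod A) \o @derA R A M) D.
  apply: additive_factor (@H1_class_surj R AM (regbimod AM)) _.
  by move=> D /H1_class_eq0 /derA_inner /H1_class_eq0.
exists iota, piA; split.
- by move=> S d T; exists (incl (S, d, T)) => //; exact: (iotaE (S, d, T)).
- move=> D; exists (derA D), (compT D), (compM D), (compS D).
  by split=> [a m|]; [exact: comp_decomp | exact: piAE].
- apply: raddf_inj => y; have [x <-] := classes_surj y.
  by rewrite iotaE => /H1_class_eq0 /incl_inner.
move=> x; split=> [|[y <-]]; last first.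
  by have [z <-] := classes_surj y; rewrite iotaE piAE /= derA_incl raddf0.
have [D <-] := H1_class_surj x; rewrite piAE.
move=> /H1_class_eq0 /incl_of_inner [z /H1_class_eq0 Dz].
by exists (classes z); rewrite iotaE /=; apply/esym/subr0_eq; rewrite -raddfB.
Qed.
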